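(* Let $\sigma\in(0,2)$, $T>0$, $h>0$, $M\in\mathbb{N}$, $\tau=T/M$, $t_n=n\tau$, $x_{\mathbf i}=h\mathbf i$. Assume $F:\mathbb{R}\to\mathbb{R}$ satisfies $F(l_1)-F(l_2)\le L_F(l_1-l_2)^+$ for all $l_1,l_2\in\mathbb{R}$, with a constant $L_F>0$, that $f\in C_b(\mathbb{R}^N\times[0,T])$ and $u_0\in C_b(\mathbb{R}^N)$, and that the CFL condition $\tau\le\frac{1}{L_FC_\sigma}h^\sigma$ holds. Then there exists a unique solution $U$ of the scheme $$U_{\mathbf i}^{n+1}=U_{\mathbf i}^n+\tau\Big[F\big(-(-\Delta_h)^{\sigma/2}U_{\mathbf i}^n\big)+f(x_{\mathbf i},t_n)\Big],\quad \mathbf i\in\mathbb{Z}^N,\ 0\le n\le M-1,\qquad U_{\mathbf i}^0=u_0(x_{\mathbf i}),$$ and it satisfies, for all $0\le n\le M$, $$\|U^n\|_{L^\infty}\le\|u_0\|_{L^\infty}+t_n\big(|F(0)|+\|f\|_{L^\infty}\big).$$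
   Context: $(\cdot)^+=\max\{0,\cdot\}$; $C_b$ denotes bounded continuous functions; $\|U^n\|_{L^\infty}=\sup_{\mathbf i}|U^n_{\mathbf i}|$. On grid functions (indexed by $\mathbf i\in\mathbb{Z}^N$), the power of the discrete Laplacian is $-(-\Delta_h)^{\sigma/2}U_{\mathbf i}=\sum_{\mathbf j\in\mathbb{Z}^N\setminus\{0\}}(U_{\mathbf i+\mathbf j}-U_{\mathbf i})\kappa_{\sigma,h,\mathbf j}$, where $\kappa_{\sigma,h,\mathbf j}=\frac{1}{h^\sigma}\frac{1}{|\Gamma(-\sigma/2)|}\int_0^\infty e^{-2Nt}\prod_{i=1}^NI_{|\mathbf j_i|}(2t)\frac{dt}{t^{1+\sigma/2}}\ge0$ and $I_m$ is the modified Bessel function of the first kind of order $m$. (Equivalently $-(-\Delta_h)^{\sigma/2}=\frac{1}{|\Gamma(-\sigma/2)|}\int_0^\infty(e^{t\Delta_h}-\mathrm{Id})\frac{dt}{t^{1+\sigma/2}}$ with $\Delta_h$ the standard second order central difference Laplacian of step $h$.) The constant $C_\sigma>0$ (independent of $h$) is defined by $\sum_{\mathbf j\ne0}\kappa_{\sigma,h,\mathbf j}=C_\sigma h^{-\sigma}$. *)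

(* Defs.v *)
From mathcomp Require Import all_boot all_order all_algebra.
From mathcomp Require Import all_classical all_reals all_analysis.
Set Implicit Arguments.
Unset Strict Implicit.
Unset Printing Implicit Defensive.
Import Order.TTheory GRing.Theory Num.Theory.
Import numFieldNormedType.Exports.
Local Open Scope classical_set_scope.
Local Open Scope ring_scope.

Section SpecialFunctions.
Variable R : realType.
Implicit Types x : R.

Definition euler_integral x : R :=
  \int[lebesgue_measure]_(t in `]0, +oo[) (t `^ (x - 1) * expR (- t)).

(* For x <= 0 the analytic continuation is obtained from
   Gamma(x + n) = x (x + 1) ... (x + n - 1) Gamma(x) with n = - floor x, so
   that 0 <= x + n < 1. The values at the poles 0, -1, -2, ... are junk. *)
Definition Gamma x : R :=
  if 0 < x then euler_integral x
  else let n := absz (Num.floor x) in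
       euler_integral (x + n%:R) / \prod_(k < n) (x + k%:R).

Definition besselI (m : nat) x : R :=
  limn (series (fun k => (x / 2) ^+ (m + k.*2) / (k`! * (m + k)`!)%:R)).

End SpecialFunctions.

Section Summation.
Variables (R : realType) (I : choiceType).

Definition abs_summable (D : set I) (a : I -> R) : Prop :=
  summable D (fun i => (a i)%:E).

(* The value is only meaningful when abs_summable D a holds. *)
Definition rsum (D : set I) (a : I -> R) : R :=
  fine (\esum_(i in D) (fun i => (a i)%:E)^\+ i)%E -
  fine (\esum_(i in D) (fun i => (a i)%:E)^\- i)%E.

End Summation.

Section FractionalLaplacian.
Variables (R : realType) (N : nat).

(* 'rV[int]_N is the index set Z^N. *)
Definition gridfun := 'rV[int]_N -> R.

Definition kappa (sigma h : R) (j : 'rV[int]_N) : R :=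
  1 / h `^ sigma * (1 / `|Gamma (- (sigma / 2))|) *
  \int[lebesgue_measure]_(t in `]0, +oo[)
    (expR (- ((2 * N)%:R * t)) *
     (\prod_(i < N) besselI (absz (j ord0 i)) (2 * t)) /
     t `^ (1 + sigma / 2)).

Definition Zstar : set 'rV[int]_N := ~` [set 0].

Definition fraclap_summand (sigma h : R) (U : gridfun) (i j : 'rV[int]_N) : R :=
  (U (i + j) - U i) * kappa sigma h j.

(* - (- Delta_h)^(sigma/2) U_i, including the leading minus sign *)
Definition neg_fraclap (sigma h : R) (U : gridfun) (i : 'rV[int]_N) : R :=
  rsum Zstar (fraclap_summand sigma h U i).

(* The constant defined by
     \sum_(j != 0) kappa sigma h j = Csigma sigma * h^(- sigma),
   read off at h = 1; esum_kappa gives the dependence on h. *)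
Definition Csigma (sigma : R) : R :=
  fine (\esum_(j in Zstar) (kappa sigma 1 j)%:E)%E.

Lemma kappa_scale (sigma h : R) j :
  kappa sigma h j = h `^ (- sigma) * kappa sigma 1 j.
Proof. by rewrite /kappa powR1 powRN divr1 mul1r !div1r mulrA. Qed.

Lemma esum_kappa (sigma h : R) : 0 < h ->
  (\esum_(j in Zstar) (kappa sigma h j)%:E =
   (h `^ (- sigma))%:E * \esum_(j in Zstar) (kappa sigma 1 j)%:E)%E.
Proof.
move=> h0; rewrite /esum -ereal_sup_pZl ?powR_gt0// image_comp.
congr (ereal_sup _); apply: eq_imagel => A [Afin _] /=.
rewrite !fsumEFin// -EFinM !fsbig_finite//= mulr_sumr; congr EFin.
by apply: eq_bigr => j _; exact: kappa_scale.
Qed.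

Definition gridpt (h : R) (i : 'rV[int]_N) : 'rV[R]_N :=
  h *: map_mx intr i.

Definition cylinder (T : R) : set ('rV[R]_N * R) :=
  [set: 'rV[R]_N] `*` `[0, T]%classic.

Definition supnorm (X : Type) (D : set X) (g : X -> R) : \bar R :=
  ereal_sup [set `|g x|%:E | x in D].

(* Only the values U n with n <= M matter. Being a solution includes that the
   series defining the operator converges absolutely whenever it is applied. *)
Definition is_solution (sigma h tau : R) (M : nat) (F : R -> R)
    (f : 'rV[R]_N * R -> R) (u0 : 'rV[R]_N -> R) (U : nat -> gridfun) : Prop :=
  [/\ forall i, U 0%N i = u0 (gridpt h i),
      forall n i, (n < M)%N ->
        abs_summable Zstar (fraclap_summand sigma h (U n) i)
    & forall n i, (n < M)%N ->
        U n.+1 i = U n i + tau * (F (neg_fraclap sigma h (U n) i) +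
                                  f (gridpt h i, n%:R * tau))].

End FractionalLaplacian.

Arguments cylinder {R} N T.

(* Main.v *)
(* The CFL condition makes one step of the scheme a monotone function of the
   previous values. Hence, if |U| <= B, the update lies between the updates of
   the constants - B and B, on which the operator vanishes, so that B grows by
   at most tau (|F 0| + |f|) per step. *)
Require Import Defs.
From mathcomp Require Import all_boot all_order all_algebra.
From mathcomp Require Import all_classical all_reals all_analysis.
From mathcomp Require Import ring lra.
Set Implicit Arguments.
Unset Strict Implicit.
Import Order.TTheory GRing.Theory Num.Theory.
Import numFieldNormedType.Exports.
Local Open Scope classical_set_scope.
Local Open Scope ring_scope.

(** The partial sums are nonnegative, but the value of [limn] is controlled only once the series
    converges. As [(m + k)! >= k!], it is dominated by [(x / 2) ^+ m] times the exponential series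
    at [(x / 2) ^+ 2]. *)
Lemma besselI_ge0 (R : realType) (m : nat) (x : R) :
  0 <= x -> 0 <= besselI m x.
Proof.
move=> x0; have y0 : 0 <= x / 2 by rewrite divr_ge0.
have u0 k : 0 <= (x / 2) ^+ (m + k.*2) / (k`! * (m + k)`!)%:R.
  by rewrite divr_ge0 ?exprn_ge0.
rewrite /besselI; apply: limr_ge; last first.
  by apply: nearW => n; rewrite /series /= sumr_ge0.
have v0 k : 0 <= (x / 2) ^+ m * exp_coeff ((x / 2) ^+ 2) k.
  by rewrite mulr_ge0 ?exprn_ge0// exp_coeff_ge0 ?exprn_ge0.
apply: (series_le_cvg u0 v0) => [k|].
  rewrite /exp_coeff /= exprD -muln2 mulnC exprM mulrA.
  rewrite ler_wpM2l ?mulr_ge0 ?exprn_ge0//.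
  rewrite lef_pV2 ?posrE ?ltr0n ?muln_gt0 ?fact_gt0//.
  by rewrite ler_nat leq_pmulr ?fact_gt0.
exact/is_cvg_seriesZ/is_cvg_series_exp_coeff.
Qed.

Lemma kappa_ge0 (R : realType) (N : nat) (sigma h : R) (j : 'rV[int]_N) :
  0 <= kappa sigma h j.
Proof.
rewrite /kappa !mulr_ge0 ?invr_ge0 ?powR_ge0//.
apply: Rintegral_ge0 => t /=; rewrite in_itv/= andbT => t0.
rewrite divr_ge0 ?powR_ge0// mulr_ge0 ?expR_ge0//.
by apply: prodr_ge0 => i _; rewrite besselI_ge0// mulr_ge0// ltW.
Qed.

Section Summation.
Variables (R : realType) (I : choiceType) (D : set I).
Implicit Types a w : I -> R.

Lemma esumZl (c : R) w : 0 <= c ->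
  (\esum_(i in D) (c * w i)%:E = c%:E * \esum_(i in D) (w i)%:E)%E.
Proof.
(* Scaling a supremum requires [0 < c]. For [c = 0] both sides vanish, even if the sum is infinite,
   since [0 * +oo = 0]. *)
rewrite le_eqVlt => /predU1P[<-|c0].
  by rewrite mul0e esum1// => i _; rewrite mul0r.
rewrite /esum -ereal_sup_pZl// image_comp.
congr (ereal_sup _); apply: eq_imagel => A [Afin _] /=.
rewrite !fsumEFin// -EFinM !fsbig_finite//= mulr_sumr; congr EFin.
Qed.

Variable w : I -> R.
Hypothesis w_fin : (\esum_(i in D) (w i)%:E \is a fin_num)%E.
Hypothesis w_ge0 : forall i, 0 <= w i.

Lemma abs_summable_le (c : R) a : 0 <= c ->
  (forall i, `|a i| <= c * w i) -> abs_summable D a.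
Proof.
move=> c0 aw; rewrite /abs_summable /summable.
apply: (@le_lt_trans _ _ (\esum_(i in D) (c * w i)%:E)%E).
  by apply: le_esum => i _; rewrite abse_EFin lee_fin.
by rewrite esumZl// -(fineK w_fin) -EFinM ltry.
Qed.

Let esum_le (c : R) (b : I -> \bar R) : 0 <= c ->
  (forall i, (0 <= b i)%E) -> (forall i, (b i <= (c * w i)%:E)%E) ->
  fine (\esum_(i in D) b i)%E <= c * fine (\esum_(i in D) (w i)%:E)%E.
Proof.
move=> c0 b0 bw; rewrite -lee_fin EFinM (fineK w_fin) -esumZl//.
have bcw : (\esum_(i in D) b i <= \esum_(i in D) (c * w i)%:E)%E.
  exact: le_esum.
(* Finiteness comes first: [fine] is faithful only on finite values. *)
rewrite fineK// ge0_fin_numE ?esum_ge0//; apply: le_lt_trans bcw _.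
by rewrite esumZl// -(fineK w_fin) -EFinM ltry.
Qed.

(** Dropping the sum of the negative part only increases the value, and the positive part stays
    below [c * w i] because this is nonnegative. *)
Lemma rsum_le (c : R) a : 0 <= c -> (forall i, a i <= c * w i) ->
  rsum D a <= c * fine (\esum_(i in D) (w i)%:E)%E.
Proof.
move=> c0 aw; rewrite /rsum.
apply: (@le_trans _ _ (fine (\esum_(i in D) (fun i => (a i)%:E)^\+ i)%E)).
  by rewrite gerBl fine_ge0// esum_ge0// => i _; exact: funeneg_ge0.
apply: esum_le => // i.
by rewrite funeposE ge_max !lee_fin aw mulr_ge0.
Qed.

Lemma rsum_ge (c : R) a : 0 <= c -> (forall i, - (c * w i) <= a i) ->
  - (c * fine (\esum_(i in D) (w i)%:E)%E) <= rsum D a.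
Proof.
move=> c0 aw; rewrite /rsum lerNl opprB.
apply: (@le_trans _ _ (fine (\esum_(i in D) (fun i => (a i)%:E)^\- i)%E)).
  by rewrite gerBl fine_ge0// esum_ge0// => i _; exact: funepos_ge0.
apply: esum_le => // i.
by rewrite funenegE ge_max -EFinN !lee_fin lerNl aw mulr_ge0.
Qed.

End Summation.

Section Step.
Variables (R : realType) (N : nat) (sigma h : R).
Hypothesis h0 : 0 < h.
Hypothesis kfin : (\esum_(j in @Zstar N) (kappa sigma 1 j)%:E \is a fin_num)%E.

Let esum_kappa_fin :
  (\esum_(j in @Zstar N) (kappa sigma h j)%:E \is a fin_num)%E.
Proof. by rewrite esum_kappa// fin_numM. Qed.

Let esum_kappaE : fine (\esum_(j in @Zstar N) (kappa sigma h j)%:E)%E =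
  Csigma N sigma * h `^ (- sigma).
Proof. by rewrite esum_kappa// fineM// mulrC. Qed.

Variables (U : gridfun R N) (B : R).
Hypothesis UB : forall i, `|U i| <= B.

Lemma fraclap_abs_summable i :
  abs_summable (@Zstar N) (fraclap_summand sigma h U i).
Proof.
have B0 : 0 <= B by apply: le_trans (UB i).
apply: (@abs_summable_le _ _ _ (kappa sigma h) _ (B + B)) => //.
- exact: addr_ge0.
- move=> j; rewrite normrM (ger0_norm (kappa_ge0 _ _ _)) ler_wpM2r ?kappa_ge0//.
  by rewrite (le_trans (ler_normB _ _))// lerD.
Qed.

(** Each increment [U (i + j) - U i] is at most [B - U i]. Keeping this gap, rather than the cruder
    [2 * B], is what allows the CFL condition to absorb the term later. *)
Lemma neg_fraclap_le i :
  neg_fraclap sigma h U i <= (B - U i) * (Csigma N sigma * h `^ (- sigma)).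
Proof.
rewrite -esum_kappaE; apply: rsum_le => //.
- exact: kappa_ge0.
- by rewrite subr_ge0 (le_trans (ler_norm _)).
- move=> j; rewrite ler_wpM2r ?kappa_ge0// lerD2r.
  by rewrite (le_trans (ler_norm _)).
Qed.

Lemma neg_fraclap_ge i :
  - ((B + U i) * (Csigma N sigma * h `^ (- sigma))) <= neg_fraclap sigma h U i.
Proof.
have UN k : - B <= U k by have := UB k; rewrite ler_norml => /andP[].
rewrite -esum_kappaE; apply: rsum_ge => //.
- exact: kappa_ge0.
- by rewrite -lerBlDl sub0r.
- move=> j; rewrite -mulNr ler_wpM2r ?kappa_ge0// opprD lerD2r; exact: UN.
Qed.

(** The one-sided condition on [F], applied to [(l, 0)] and [(0, l)], compares [F l] with [F 0] from
    both sides. Under the CFL condition the resulting upward move is at most the distance [B - U i]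
    to the upper barrier, and the downward one at most [B + U i]. *)
Lemma scheme_step_bound (F : R -> R) (LF tau g A : R) i : 0 <= tau -> 0 <= LF ->
  (forall l1 l2 : R, F l1 - F l2 <= LF * Num.max 0 (l1 - l2)) ->
  tau * LF * (Csigma N sigma * h `^ (- sigma)) <= 1 ->
  `|g| <= A ->
  `|U i + tau * (F (neg_fraclap sigma h U i) + g)| <= B + tau * (`|F 0| + A).
Proof.
move=> tau0 LF0 HF cfl gA.
have := neg_fraclap_le i; have := neg_fraclap_ge i.
set C := Csigma N sigma * _ in cfl *; set l := neg_fraclap _ _ _ _ => lge lle.
have C0 : 0 <= C.
  rewrite mulr_ge0 ?powR_ge0 ?fine_ge0 ?esum_ge0// => j _.
  by rewrite lee_fin kappa_ge0.
have /andP[U1 U2] : - B <= U i <= B by rewrite -ler_norml.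
have Fub : F l - F 0 <= LF * ((B - U i) * C).
  apply: le_trans (HF _ _) _; rewrite ler_wpM2l// ge_max subr0 lle andbT.
  by rewrite mulr_ge0// subr_ge0.
have Flb : F 0 - F l <= LF * ((B + U i) * C).
  apply: le_trans (HF _ _) _; rewrite ler_wpM2l// ge_max sub0r lerNl lge andbT.
  by rewrite mulr_ge0// -lerBlDl sub0r.
have cub : tau * LF * C * (B - U i) <= B - U i.
  by rewrite ler_piMl// subr_ge0.
have clb : tau * LF * C * (B + U i) <= B + U i.
  by rewrite ler_piMl// -lerBlDl sub0r.
(* Once every bound is multiplied by [tau], the goal is linear in the monomials that occur. *)
have Fub' := ler_wpM2l tau0 Fub; have Flb' := ler_wpM2l tau0 Flb.
have F0u := ler_wpM2l tau0 (ler_norm (F 0)).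
have F0l := ler_wpM2l tau0 (ler_norm (- F 0)); rewrite normrN in F0l.
have gu := ler_wpM2l tau0 (le_trans (ler_norm g) gA).
have gl : tau * - g <= tau * A.
  by rewrite ler_wpM2l// (le_trans (ler_norm _))// normrN.
by rewrite ler_norml; apply/andP; split; lra.
Qed.

End Step.

Section SupNorm.
Variables (R : realType) (X : Type) (D : set X) (g : X -> R).

(** A point of [D] excludes the value [-oo], the supremum of the empty set. *)
Lemma supnorm_fin_num : D !=set0 -> [bounded g z | z in D] ->
  supnorm D g \is a fin_num.
Proof.
(* Boundedness provides a bound by every real strictly above [A0], hence the choice [A0 + 1]. *)
move=> [x Dx] [A0 [_ /(_ (A0 + 1))]]; rewrite ltrDl ltr01 => /(_ isT).
set A := A0 + 1 => gA.
rewrite ge0_fin_numE; last first.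
  apply: (@le_trans _ _ `|g x|%:E); first by rewrite lee_fin.
  by apply: ereal_sup_ubound; exists x.
apply: (@le_lt_trans _ _ A%:E); last exact: ltry.
by apply: ge_ereal_sup => _ [y Dy <-]; rewrite lee_fin; exact: gA.
Qed.

Lemma le_fine_supnorm x : supnorm D g \is a fin_num -> D x ->
  `|g x| <= fine (supnorm D g).
Proof.
by move=> gfin Dx; rewrite -lee_fin fineK//; apply: ereal_sup_ubound; exists x.
Qed.

End SupNorm.

(** The recursion is total because [rsum] has a value even without summability; absolute convergence
    is proved afterwards from the bound on each level. *)
Fixpoint scheme (R : realType) (N : nat) (sigma h tau : R) (F : R -> R)
    (f : 'rV[R]_N * R -> R) (u0 : 'rV[R]_N -> R) (n : nat) : gridfun R N :=
  if n is n'.+1 then fun i =>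
    scheme sigma h tau F f u0 n' i +
    tau * (F (neg_fraclap sigma h (scheme sigma h tau F f u0 n') i) +
           f (gridpt h i, n'%:R * tau))
  else fun i => u0 (gridpt h i).

Unset Implicit Arguments.

Theorem theorem3p4 (R : realType) (N M : nat) (sigma T h tau LF : R)
    (F : R -> R) (f : 'rV[R]_N * R -> R) (u0 : 'rV[R]_N -> R) :
  (0 < N)%N -> 0 < sigma -> sigma < 2 -> 0 < T -> 0 < h -> (0 < M)%N ->
  tau = T / M%:R ->
  0 < LF ->
  (forall l1 l2 : R, F l1 - F l2 <= LF * Num.max 0 (l1 - l2)) ->
  {within cylinder N T, continuous f} ->
  [bounded f z | z in cylinder N T] ->
  continuous u0 ->
  bounded_fun u0 ->
  tau <= 1 / (LF * Csigma N sigma) * h `^ sigma ->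
  exists U : nat -> gridfun R N,
    [/\ is_solution sigma h tau M F f u0 U,
        forall V : nat -> gridfun R N, is_solution sigma h tau M F f u0 V ->
          forall n i, (n <= M)%N -> V n i = U n i
      & forall n, (n <= M)%N ->
          (supnorm setT (U n) <=
           supnorm setT u0 +
           (n%:R * tau)%:E *
             (`|F 0|%:E + supnorm (cylinder N T) f))%E].
Proof.
move=> _ _ _ T0 h0 M0 tauE LF0 HF _ fbnd _ u0bnd cfl.
have MR0 : 0 < M%:R :> R by rewrite ltr0n.
have tau0 : 0 < tau by rewrite tauE divr_gt0.
have Cneq0 : Csigma N sigma != 0.
  by apply: contraTneq cfl => ->; rewrite mulr0 invr0 mulr0 mul0r -ltNge.
(* An infinite sum would give [Csigma] the junk value [fine +oo = 0] and, as
   [1 / 0 = 0], the CFL bound would contradict [0 < tau]. *)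
have kfin : (\esum_(j in @Zstar N) (kappa sigma 1 j)%:E \is a fin_num)%E.
  by move: Cneq0; rewrite /Csigma; case: esum => //=; rewrite eqxx.
have C0 : 0 < Csigma N sigma.
  rewrite lt_neqAle eq_sym Cneq0 fine_ge0// esum_ge0// => j _.
  by rewrite lee_fin kappa_ge0.
have cfl1 : tau * LF * (Csigma N sigma * h `^ (- sigma)) <= 1.
  have hs0 : 0 < h `^ sigma by exact: powR_gt0.
  move: cfl; rewrite mul1r mulrC ler_pdivlMr ?mulr_gt0// powRN mulrA.
  by rewrite ler_pdivrMr// mul1r mulrA.
have u0fin : supnorm setT u0 \is a fin_num.
  by apply: supnorm_fin_num => //; exists 0.
have cyl n (x : 'rV[R]_N) : (n <= M)%N -> cylinder N T (x, n%:R * tau).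
  move=> nM; split => //=; rewrite in_itv/= (mulr_ge0 _ (ltW tau0))//= tauE mulrCA.
  by rewrite ler_piMr ?(ltW T0)// ler_pdivrMr// mul1r ler_nat.
have ffin : supnorm (cylinder N T) f \is a fin_num.
  by apply: supnorm_fin_num => //; exists (0, 0%:R * tau); exact: cyl.
pose U := scheme sigma h tau F f u0.
pose B n : R := fine (supnorm setT u0) +
  n%:R * tau * (`|F 0| + fine (supnorm (cylinder N T) f)).
(* This bound serves twice: it gives the absolute convergence that [is_solution] demands, and the
   final estimate. *)
have UB n : (n <= M)%N -> forall i, `|U n i| <= B n.
  elim: n => [_ i|n IH nM i].
    by rewrite /B !mul0r addr0; exact: (le_fine_supnorm u0fin).
  have -> : B n.+1 = B n + tau * (`|F 0| + fine (supnorm (cylinder N T) f)).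
    by rewrite /B -natr1; ring.
  apply: (scheme_step_bound h0 kfin (IH (ltnW nM)) i (ltW tau0) (ltW LF0)) => //.
  by apply: le_fine_supnorm => //; exact/cyl/ltnW.
exists U; split.
- split => // n i nM.
  exact: (fraclap_abs_summable h0 kfin (UB n (ltnW nM))).
- move=> V [V0 _ VS]; elim=> [i _|n IH i nM]; first by rewrite V0.
  (* The operator is nonlocal, so equality of the whole grid functions at level [n] is needed, not
     just at [i]. *)
  have VU : V n = U n by apply/funext => k; exact/IH/ltnW.
  by rewrite VS// VU.
- move=> n nM; apply: ge_ereal_sup => _ [i _ <-].
  (* Both norms being finite, the extended right-hand side is the real number [B n]. *)
  rewrite -(fineK u0fin) -(fineK ffin) -EFinD lee_fin.
  exact: UB.
Qed.
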